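(* Let $\alpha\in(0,1)$ be irrational and $\beta\in(0,1)$. Let the limit $\hat\ell\in\mathbb{Z}_{\ge0}\cup\{\infty\}$ and the right-admissible digit string $\langle\hat b_k\rangle_1^{\hat\ell}$ be the output of the absolute base-$\alpha$ expansion algorithm applied to the seed $1-\beta$, and let $T_n^\searrow=-\sum_{k=1}^n\hat b_kq_{k-1}^*$ for all $0\le n<\hat\ell+1$. Then the sequence $\langle T_n^\searrow\rangle_0^{\hat\ell}$ is the solution sequence to the total over $(\alpha,\beta)$-linear approximate problem; that is, it is a sequence of total over $(\alpha,\beta)$-approximates which is a general solution: (i) $|T_n^\searrow|\le q_n$ for $1\le n<\hat\ell+1$; (ii) $0<\|\beta-T_n^\searrow\alpha\|<|\theta_{n-1}|$ for $1\le n<\hat\ell$; (iii) $\|\beta-T_{\hat\ell}^\searrow\alpha\|=0$, read as $\lim_{n\to\infty}\|\beta-T_n^\searrow\alpha\|=0$ when $\hat\ell=\infty$.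
   Context: $(r)=r-\lfloor r\rfloor$ is the fractional part of a real $r$, and $\|r\|=\min\{(r),1-(r)\}$ is the distance from $r$ to the nearest integer; $\infty\pm1=\infty$; empty sums are $0$. For irrational $\alpha\in(0,1)$, set $\alpha_0=\alpha$ and, for $k\ge1$, $a_k=\lfloor 1/\alpha_{k-1}\rfloor$, $\alpha_k=1/\alpha_{k-1}-a_k$ (the continued fraction digits of $\alpha$). Let $p_{-1}=1,\ p_0=0,\ p_k=a_kp_{k-1}+p_{k-2}$ and $q_{-1}=0,\ q_0=1,\ q_k=a_kq_{k-1}+q_{k-2}$ for $k\ge1$; $q_k^*=(-1)^kq_k$; $\theta_k=q_k\alpha-p_k$ for $k\ge-1$. The absolute base-$\alpha$ expansion algorithm applied to a seed $x\in[0,1)$: $x_0=x$; for $k=1,2,\dots$, as long as $x_{k-1}>0$, put $b_k=\lfloor x_{k-1}/|\theta_{k-1}|\rfloor$ and $x_k=x_{k-1}-b_k|\theta_{k-1}|$. If $x_\ell=0$ for a first index $\ell$, the algorithm stops and $\ell$ is the limit; otherwise $\ell=\infty$. It gives $x=\sum_{k=1}^\ell b_k|\theta_{k-1}|$. A digit string $\langle b_k\rangle_1^\ell$ of integers is right-admissible if (a) $0\le b_k\le a_k$ for all $k$, and $b_\ell\ge1$ (for $\ell=\infty$: $\limsup_k b_k\ge1$); (b) $b_k=a_k\implies b_{k+1}=0$ for all $1\le k<\ell-1$; (c) if $\ell=\infty$, then $b_k\le a_k-1$ for infinitely many odd and infinitely many even indices $k$. An $(\alpha,\beta)$-approximate is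 an integer $m$, with iterate $(m\alpha)$; ''total'' means that positive, negative and zero integers are all allowed. The approximate $m$ is over $\beta$ when $(m\alpha)\in[\beta,\beta+.5)$ modulo $1$, and is otherwise under.
   Formalization: That T_n is an over approximate is claimed only for n ≥ 2, or for n in {0,1} when the remainder x_n of the expansion of 1−β is below 1/2; otherwise it is false (β = 1/4, T_0 = 0). *)

(* Defs.v *)
From mathcomp Require Import all_boot all_order all_algebra.
From mathcomp Require Import all_classical all_reals.
From mathcomp Require Import ereal topology normedtype sequences.

Set Implicit Arguments.
Unset Strict Implicit.
Unset Printing Implicit Defensive.

Import Order.TTheory GRing.Theory Num.Theory.
Import numFieldNormedType.Exports.

Local Open Scope classical_set_scope.
Local Open Scope ring_scope.

Section Reals.
Context {R : realType}.
Implicit Types (r alpha beta x : R) (k n : nat).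

Definition frac r : R := r - (Num.floor r)%:~R.

Definition dist_int r : R := Num.min (frac r) (1 - frac r).

Fixpoint cf_rem alpha k : R :=
  if k is k'.+1 then
    (cf_rem alpha k')^-1 - (Num.floor (cf_rem alpha k')^-1)%:~R
  else alpha.

(* a_k; meaningful for 1 <= k only. *)
Definition cf_digit alpha k : int := Num.floor (cf_rem alpha k.-1)^-1.

(* The pair (u_{k-1}, u_k), where u_{-1} = u, u_0 = v and
   u_k = a_k u_{k-1} + u_{k-2} for 1 <= k. *)
Fixpoint cf_pair alpha (u v : int) k : int * int :=
  if k is k'.+1 then
    let w := cf_pair alpha u v k' in
    (w.2, cf_digit alpha k * w.2 + w.1)
  else (u, v).

Definition cf_p alpha k : int := (cf_pair alpha 1 0 k).2.
Definition cf_q alpha k : int := (cf_pair alpha 0 1 k).2.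

Definition cf_qstar alpha k : int := (-1) ^+ k * cf_q alpha k.

Definition theta alpha k : R := (cf_q alpha k)%:~R * alpha - (cf_p alpha k)%:~R.

(* x_k.  The recursion is not stopped at the first zero, but from there on
   all the remainders and digits are 0; they lie beyond the limit. *)
Fixpoint abs_rem alpha x k : R :=
  if k is k'.+1 then
    abs_rem alpha x k'
    - (Num.floor (abs_rem alpha x k' / `|theta alpha k'|))%:~R
      * `|theta alpha k'|
  else x.

(* b_k; meaningful for 1 <= k only. *)
Definition abs_digit alpha x k : int :=
  Num.floor (abs_rem alpha x k.-1 / `|theta alpha k.-1|).

(* The first l with x_l = 0, or None, which stands for infinity. *)
Definition abs_limit alpha x : option nat :=
  if pselect (exists l, abs_rem alpha x l == 0) is left h
  then Some (ex_minn h) else None.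

(* n < l + 1 and n < l, for l a natural number or infinity (None). *)
Definition le_limit n (l : option nat) : Prop :=
  if l is Some l' then (n <= l')%N else True.
Definition lt_limit n (l : option nat) : Prop :=
  if l is Some l' then (n < l')%N else True.

(* For l infinite the limsup is taken in the extended reals, as the digits may
   be unbounded.  The bound k < l - 1 is encoded as k + 1 < l. *)
Definition right_admissible alpha (l : option nat) (b : nat -> int) : Prop :=
  [/\ forall k, (1 <= k)%N -> le_limit k l -> 0 <= b k <= cf_digit alpha k,
      (if l is Some l' then (1 <= l')%N -> 1 <= b l'
       else (1 <= limn_esup (fun k => ((b k)%:~R : R)%:E))%E),
      forall k, (1 <= k)%N -> lt_limit k.+1 l ->
        b k = cf_digit alpha k -> b k.+1 = 0
    & l = None -> forall parity : bool,
        infinite_set [set k | [/\ (1 <= k)%N, odd k = parity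
                                & b k <= cf_digit alpha k - 1]] ].

(* (m alpha) lies in [beta, beta + 1/2) modulo 1; m is any integer. *)
Definition over_approximate alpha beta (m : int) : Prop :=
  exists j : int, beta <= frac (m%:~R * alpha) + j%:~R < beta + 2^-1.

Definition general_solution alpha beta (l : option nat) (T : nat -> int)
    : Prop :=
  [/\ forall n, (1 <= n)%N -> le_limit n l -> `|T n| <= cf_q alpha n,
      forall n, (1 <= n)%N -> lt_limit n l ->
        0 < dist_int (beta - (T n)%:~R * alpha) < `|theta alpha n.-1|
    & if l is Some l' then dist_int (beta - (T l')%:~R * alpha) = 0
      else dist_int (beta - (T n)%:~R * alpha) @[n --> \oo] --> (0 : R) ].

Definition T_down alpha (b : nat -> int) n : int :=
  - \sum_(1 <= k < n.+1) b k * cf_qstar alpha k.-1.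

End Reals.

(* Main.v *)
(* Put q_k^* alpha = |theta_k| + (-1)^k p_k into the definition of T_n: modulo 1,
   T_n alpha is x_n - x_0 = x_n + beta, where x_n is the n-th remainder of the
   expansion of 1 - beta.  Hence T_n is over beta once x_n < 1/2, and
   ||beta - T_n alpha|| = min(x_n, 1 - x_n), so everything about the distances
   follows from 0 <= x_n < |theta_{n-1}| and |theta_n| -> 0. *)

Require Import Defs.
From mathcomp Require Import all_boot all_order all_algebra.
From mathcomp Require Import all_classical all_reals.
From mathcomp Require Import ereal topology normedtype sequences.
From mathcomp Require Import ring lra zify.
Import Order.TTheory GRing.Theory Num.Theory.
Import numFieldNormedType.Exports.

Local Open Scope classical_set_scope.
Local Open Scope ring_scope.

(** * Auxiliary facts: irrationality, limsup, distance to the nearest integer *)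

Lemma irrational_invB {R : realType} (x : R) (z : int) :
  irrational x -> irrational (x^-1 - z%:~R).
Proof.
apply: contra_not => -[q _ qE]; exists (q + z%:~R)^-1 => //.
by rewrite fmorphV rmorphD /= qE ratr_int subrK invrK.
Qed.

Lemma finite_set_nat_ub (A : set nat) :
  finite_set A -> exists N, forall n, A n -> (n < N)%N.
Proof.
move=> /finite_fsetP[X ->]; exists (\max_(i <- finmap.enum_fset X) i).+1 => n /= nX.
by rewrite ltnS; apply: leq_bigmax_seq.
Qed.

(** Every tail supremum is at least [c], and the limsup is their limit. *)
Lemma limn_esup_ge {R : realType} (u : nat -> \bar R) (c : \bar R) :
  (forall N, exists2 k, (N <= k)%N & (c <= u k)%E) -> (c <= limn_esup u)%E.
Proof.
move=> cu; rewrite limn_esup_lim; apply: lime_ge; first exact: is_cvg_esups.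
near=> n; have [k nk cuk] := cu n.
by apply: (le_trans cuk); apply: ereal_sup_ubound; exists k.
Unshelve. all: by end_near.
Qed.

Lemma frac_addz {R : realType} (y : R) (z : int) :
  0 <= y < 1 -> Defs.frac (y + z%:~R) = y.
Proof.
move=> y01; rewrite /Defs.frac (@floor_def _ _ z) ?addrK// rmorphD /=; lra.
Qed.

Lemma dist_int_zsub {R : realType} (y : R) (z : int) :
  0 <= y < 1 -> dist_int (z%:~R - y) = Num.min y (1 - y).
Proof.
(* The representative [1 - y] used below lies in [[0, 1)] only if [y] is nonzero. *)
move=> y01; rewrite /dist_int; have [->|y0] := eqVneq y 0.
  by rewrite subr0 -[z%:~R]add0r frac_addz ?lexx ?ltr01.
have -> : z%:~R - y = (1 - y) + (z - 1)%:~R by rewrite rmorphB /=; ring.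
by rewrite frac_addz; [rewrite subKr minC | lra].
Qed.

(** * Continued fraction remainders and the decay of |theta_n| *)

Section ContinuedFraction.
Context {R : realType} (alpha : R).

(* |theta_{n-1}|, the value at [n = 0] being |theta_{-1}| = 1. *)
Definition cf_gap n : R := \prod_(i < n) cf_rem alpha i.

Context (alpha01 : 0 < alpha < 1) (alpha_irr : irrational alpha).

Lemma cf_rem_irrational k : irrational (cf_rem alpha k).
Proof. by elim: k => //= k; exact: irrational_invB. Qed.

(** For positive [k] this is a fractional part, and irrationality excludes 0. *)
Lemma cf_rem_itv k : 0 < cf_rem alpha k < 1.
Proof.
have irr := cf_rem_irrational k; case: k irr => // k /= irr.
set x := (cf_rem alpha k)^-1 in irr *.
have /andP[fle flt] := floor_itv x; rewrite rmorphD /= in flt.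
rewrite subr_gt0 lt_neqAle fle andbT ltrBlDl flt andbT.
apply/eqP => xE; apply: irr; exists 0 => //.
by apply/esym/eqP; rewrite rmorph0 subr_eq0 xE.
Qed.

Lemma cf_digit_ge1 k : 1 <= cf_digit alpha k.
Proof.
have /andP[r0 r1] := cf_rem_itv k.-1.
by rewrite floor_ge_int invr_ge1 ?unitfE ?gt_eqF// ?ltW.
Qed.

Lemma cf_remS k :
  cf_rem alpha k.+1 = (cf_rem alpha k)^-1 - (cf_digit alpha k.+1)%:~R.
Proof. by []. Qed.

Lemma cf_gapS n : cf_gap n.+1 = cf_gap n * cf_rem alpha n.
Proof. exact: big_ord_recr. Qed.

Lemma cf_gap0 : cf_gap 0 = 1.
Proof. exact: big_ord0. Qed.

Lemma cf_gap_gt0 n : 0 < cf_gap n.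
Proof. by apply: prodr_gt0 => i _; have /andP[] := cf_rem_itv i. Qed.

(** This is [cf_remS] multiplied by [cf_gap n.+1]. *)
Lemma cf_gap_rec n :
  cf_gap n = (cf_digit alpha n.+1)%:~R * cf_gap n.+1 + cf_gap n.+2.
Proof.
have /andP[r0 _] := cf_rem_itv n.
by rewrite !cf_gapS cf_remS; field; rewrite gt_eqF.
Qed.

(** Write g_n for [cf_gap n]. As a_{n+1} >= 1 and the gaps decrease, g_n >= g_{n+1} + g_{n+2} >= 2
    g_{n+2}. *)
Lemma cf_gapSS_le n : 2 * cf_gap n.+2 <= cf_gap n.
Proof.
have := cf_gap_rec n; have := cf_gap_gt0 n.+1.
have /andP[r0 r1] := cf_rem_itv n.+1.
have := cf_gapS n.+1.
have : 1 <= (cf_digit alpha n.+1)%:~R :> R by rewrite ler1z cf_digit_ge1.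
nra.
Qed.

Lemma cf_gap_le1 n : cf_gap n <= 1.
Proof.
elim: n => [|n IHn]; first by rewrite cf_gap0.
have /andP[r0 r1] := cf_rem_itv n.
by rewrite cf_gapS mulr_ile1// ltW// cf_gap_gt0.
Qed.

(** Decay of order 1/n suffices and compares with the harmonic sequence. The induction goes two
    steps at a time: halving the gap outweighs the growth of the factor, since n + 4 <= 2 (n + 2).
    The constant 3 covers the base case n = 1. *)
Lemma cf_gap_bound n : n.+2%:R * cf_gap n <= 3.
Proof.
suff : n.+2%:R * cf_gap n <= 3 /\ n.+3%:R * cf_gap n.+1 <= 3 by case.
elim: n => [|n [IH0 IH1]]; split=> //.
- by rewrite cf_gap0; lra.
- by have := cf_gap_le1 1; lra.
have -> : n.+4%:R = n.+2%:R + 2 :> R by rewrite -natrD addn2.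
have : 2 <= n.+2%:R :> R by rewrite ler_nat.
by have := cf_gapSS_le n; have := cf_gap_gt0 n.+2; nra.
Qed.

Lemma cvg_cf_gap : cf_gap @ \oo --> (0 : R).
Proof.
have h3 : (fun n => 3 * harmonic n : R) @ \oo --> (0 : R).
  by rewrite -[0](mulr0 3); apply: cvgMr; exact: cvg_harmonic.
apply: (squeeze_cvgr _ (cvg_cst 0) h3); near=> n.
rewrite (ltW (cf_gap_gt0 n)) /= ler_pdivlMr// mulrC.
apply: le_trans (cf_gap_bound n).
by rewrite ler_wpM2r ?ler_nat// ltW// cf_gap_gt0.
Unshelve. all: by end_near.
Qed.

Lemma cf_gap_small e : 0 < e -> exists N, forall n, (N <= n)%N -> cf_gap n < e.
Proof.
move=> e0; have /cvgr0Pnorm_lt/(_ _ e0)[N _ Ne] := cvg_cf_gap.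
by exists N => n /Ne; rewrite gtr0_norm// cf_gap_gt0.
Qed.

(** By [cf_gap_rec] the signed gaps satisfy the recurrence of p and q, and so does theta, being
    linear in them; agreement at two consecutive indices propagates. *)
Lemma thetaE n : theta alpha n = (-1) ^+ n * cf_gap n.+1.
Proof.
suff : theta alpha n = (-1) ^+ n * cf_gap n.+1 /\
       theta alpha n.+1 = (-1) ^+ n.+1 * cf_gap n.+2 by case.
elim: n => [|n [IH0 IH1]]; split=> //.
- by rewrite /theta /cf_q /cf_p /= cf_gapS cf_gap0 /=; ring.
- have := cf_gap_rec 0; rewrite cf_gapS cf_gap0 /theta /cf_q /cf_p /=.
  by rewrite mulr1 mulr0 addr0 add0r; lra.
have -> : theta alpha n.+2 =
    (cf_digit alpha n.+2)%:~R * theta alpha n.+1 + theta alpha n.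
  by rewrite /theta /cf_q /cf_p /= !rmorphD !rmorphM /=; ring.
by rewrite IH0 IH1 (cf_gap_rec n.+1) !exprS; ring.
Qed.

Lemma normr_theta n : `|theta alpha n| = cf_gap n.+1.
Proof. by rewrite thetaE normrMsign gtr0_norm ?cf_gap_gt0. Qed.

(** * The integers q_n^* and T_n *)

Lemma cf_qstar_mul n :
  (cf_qstar alpha n)%:~R * alpha = cf_gap n.+1 + ((-1) ^+ n * cf_p alpha n)%:~R.
Proof.
have := thetaE n; rewrite /theta => /eqP; rewrite subr_eq => /eqP qE.
rewrite /cf_qstar !rmorphM /= -mulrA qE !rmorphXn /= rmorphN1 mulrDr mulrA.
by rewrite -expr2 sqrr_sign mul1r.
Qed.

Lemma cf_pair_q_ge0 n :
  0 <= (cf_pair alpha 0 1 n).1 /\ 0 <= (cf_pair alpha 0 1 n).2.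
Proof.
elim: n => //= n [IH1 IH2]; have := cf_digit_ge1 n.+1; split=> //.
by rewrite addr_ge0 ?mulr_ge0//; lia.
Qed.

Lemma T_down0 (b : nat -> int) : T_down alpha b 0 = 0.
Proof. by rewrite /T_down big_geq// oppr0. Qed.

Lemma T_downS (b : nat -> int) n :
  T_down alpha b n.+1 = T_down alpha b n - b n.+1 * cf_qstar alpha n.
Proof. by rewrite /T_down [in LHS]big_nat_recr//= opprD. Qed.

(* Up to the sign (-1)^n the partial sums satisfy u_{n+1} = b_{n+1} q_n - u_n,
   which preserves - q_{n-1} <= u_n <= q_n. *)
Lemma T_down_norm_le (b : nat -> int) n :
  (forall k, 0 <= b k.+1 <= cf_digit alpha k.+1) ->
  (0 < n)%N -> `|T_down alpha b n| <= cf_q alpha n.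
Proof.
move=> b_itv n0; pose w := cf_pair alpha 0 1.
have u_itv m : - (w m).1 <= (-1) ^+ m * T_down alpha b m <= (w m).2.
  elim: m => [|m]; first by rewrite T_down0 mulr0.
  have [_ q0] := cf_pair_q_ge0 m.
  have -> : (-1) ^+ m.+1 * T_down alpha b m.+1 =
      b m.+1 * (w m).2 - (-1) ^+ m * T_down alpha b m.
    rewrite T_downS exprS mulN1r mulrBr !mulNr opprK addrC; congr (_ - _).
    by rewrite /cf_qstar mulrCA signrMK.
  rewrite /= -/(w m) in q0 *; set u := _ * T_down _ _ _; have := b_itv m.
  nia.
rewrite -[leLHS]mul1r -(normr_sign _ n) -normrM ler_norml.
have /andP[le1 ->] := u_itv n; rewrite andbT; apply: le_trans le1.
(* The lower bound -q_{n-1} suffices: q_{n-1} <= q_n because a_n >= 1. *)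
rewrite lerN2; case: n n0 {u_itv} => // n _ /=.
have [] := cf_pair_q_ge0 n; have := cf_digit_ge1 n.+1.
by rewrite /cf_q /=; nia.
Qed.


(** * Remainders and digits of the expansion *)

Context (x : R) (x01 : 0 <= x < 1).

Lemma abs_digitS n :
  abs_digit alpha x n.+1 = Num.floor (abs_rem alpha x n / cf_gap n.+1).
Proof. by rewrite /abs_digit normr_theta. Qed.

Lemma abs_remS n : abs_rem alpha x n.+1 =
  abs_rem alpha x n - (abs_digit alpha x n.+1)%:~R * cf_gap n.+1.
Proof. by rewrite /= abs_digitS normr_theta. Qed.

Lemma abs_digit_itv n :
  (abs_digit alpha x n.+1)%:~R * cf_gap n.+1 <= abs_rem alpha x n <
  ((abs_digit alpha x n.+1)%:~R + 1) * cf_gap n.+1.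
Proof.
have g0 := cf_gap_gt0 n.+1.
rewrite -ler_pdivlMr// -ltr_pdivrMr// abs_digitS.
by have := floor_itv (abs_rem alpha x n / cf_gap n.+1); rewrite rmorphD.
Qed.

(** x_n is a remainder of division by |theta_{n-1}|; at n = 0 the bound is the hypothesis on the
    seed, as |theta_{-1}| = 1. *)
Lemma abs_rem_itv n : 0 <= abs_rem alpha x n < cf_gap n.
Proof.
case: n => [|n]; first by rewrite cf_gap0.
by rewrite abs_remS; have := abs_digit_itv n; lra.
Qed.

Lemma abs_digit_eq0 n :
  abs_rem alpha x n < cf_gap n.+1 -> abs_digit alpha x n.+1 = 0.
Proof.
move=> lt_gap; have /andP[ge0 _] := abs_rem_itv n; have g0 := cf_gap_gt0 n.+1.
rewrite abs_digitS; apply: floor_def.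
by rewrite divr_ge0 ?(ltW g0)//= ltr_pdivrMr// add0r mul1r.
Qed.

(** x_n < g_n = a_{n+1} g_{n+1} + g_{n+2} < (a_{n+1} + 1) g_{n+1}, with g for [cf_gap]. *)
Lemma abs_digit_bound n :
  0 <= abs_digit alpha x n.+1 <= cf_digit alpha n.+1.
Proof.
have /andP[ge0 ltg] := abs_rem_itv n; have g0 := cf_gap_gt0 n.+1.
rewrite abs_digitS floor_ge0 divr_ge0 ?(ltW g0)//=.
rewrite -ltzD1 floor_lt_int ltr_pdivrMr//; apply: (lt_le_trans ltg).
rewrite rmorphD /= mulrDl mul1r cf_gap_rec lerD2l cf_gapS.
by have /andP[r0 r1] := cf_rem_itv n.+1; rewrite ger_pMr ?ltW.
Qed.

(** A maximal digit leaves x_{n+1} < g_n - a_{n+1} g_{n+1} = g_{n+2}, with g for [cf_gap]. *)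
Lemma abs_digit_max_next n :
  abs_digit alpha x n.+1 = cf_digit alpha n.+1 -> abs_digit alpha x n.+2 = 0.
Proof.
move=> bE; apply: abs_digit_eq0; rewrite abs_remS bE.
by have /andP[_] := abs_rem_itv n; rewrite cf_gap_rec; lra.
Qed.

(** If all late digits vanished, the remainder would be a positive constant below gaps that tend to
    0. *)
Lemma abs_digit_frequently_gt0 : (forall n, abs_rem alpha x n != 0) ->
  forall N, exists2 k, (N <= k)%N & 1 <= abs_digit alpha x k.
Proof.
move=> x_neq0 N; apply: contrapT => b_lt1.
have b0 n : (N <= n)%N -> abs_digit alpha x n.+1 = 0.
  move=> Nn; have := abs_digit_bound n.
  have [b1|] := leP 1 (abs_digit alpha x n.+1); last lia.
  by case: b_lt1; exists n.+1 => //; exact: leqW.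
have x_cst j : abs_rem alpha x (N + j) = abs_rem alpha x N.
  elim: j => [|j IHj]; first by rewrite addn0.
  by rewrite addnS abs_remS b0 ?leq_addr// mul0r subr0.
have /andP[xN0 _] := abs_rem_itv N.
have [|M gM] := cf_gap_small (abs_rem alpha x N).
  by rewrite lt_neqAle eq_sym x_neq0.
have /andP[_] := abs_rem_itv (N + M); rewrite x_cst.
by have := gM _ (leq_addl N M); lra.
Qed.

(* If b_{n+1} = a_{n+1} then b_{n+2} = 0, so the positive defect
   |theta_{n-1}| - x_n recurs two steps later; were this to happen at all late
   indices of one parity, the defect could not tend to 0. *)
Lemma abs_digit_frequently_lt (parity : bool) :
  infinite_set [set k | [/\ (1 <= k)%N, odd k = parity
    & abs_digit alpha x k <= cf_digit alpha k - 1]].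
Proof.
move=> /finite_set_nat_ub[N b_lt].
have b_max n : (N <= n.+1)%N -> odd n.+1 = parity ->
    abs_digit alpha x n.+1 = cf_digit alpha n.+1.
  move=> Nn n_par; have := abs_digit_bound n.
  have [le_b|] := leP (abs_digit alpha x n.+1) (cf_digit alpha n.+1 - 1);
    last lia.
  by have := b_lt n.+1 (And3 isT n_par le_b); rewrite ltnNge Nn.
(* The offset makes [n.+1] below at least [N] and of the given parity. *)
pose m := (N.*2 + ~~ parity)%N.
pose d n := cf_gap n - abs_rem alpha x n.
have d_cst j : d (m + j.*2)%N = d m.
  elim: j => [|j IHj]; first by rewrite addn0.
  rewrite -{}IHj doubleS !addnS; set n := (m + j.*2)%N.
  have bE : abs_digit alpha x n.+1 = cf_digit alpha n.+1.
    apply: b_max; first by rewrite /n /m; lia.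
    by rewrite /= /n /m !oddD !odd_double addbF /=; case: (parity).
  rewrite /d abs_remS abs_digit_max_next// mul0r subr0 abs_remS bE.
  by rewrite (cf_gap_rec n); ring.
have [|M gM] := cf_gap_small (d m).
  by rewrite /d subr_gt0; have /andP[] := abs_rem_itv m.
have := gM (m + M.*2)%N; rewrite -(d_cst M) /d.
have /andP[x0 _] := abs_rem_itv (m + M.*2)%N.
by have -> : (M <= m + M.*2)%N by [lia]; move=> /(_ isT); lra.
Qed.

(** Each step subtracts b_{n+1} q_n^* alpha, which modulo 1 is b_{n+1} |theta_n| = x_n - x_{n+1};
    the sum telescopes. *)
Lemma T_down_mod1 n : exists z : int,
  (T_down alpha (abs_digit alpha x) n)%:~R * alpha =
  abs_rem alpha x n - x + z%:~R.
Proof.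
elim: n => [|n [z IHn]].
  by exists 0; rewrite T_down0 /= mul0r subrr add0r.
exists (z - abs_digit alpha x n.+1 * ((-1) ^+ n * cf_p alpha n)).
rewrite T_downS abs_remS !rmorphB /= mulrBl {}IHn rmorphM /= -mulrA cf_qstar_mul.
by rewrite [in RHS]rmorphM /=; ring.
Qed.

End ContinuedFraction.

(** * The limit as the first zero of the remainders *)

Lemma abs_limit_some {R : realType} {alpha x : R} {l} :
  abs_limit alpha x = Some l ->
  abs_rem alpha x l = 0 /\
  (forall n, (n < l)%N -> abs_rem alpha x n != 0).
Proof.
rewrite /abs_limit; case: pselect => // h [<-].
case: ex_minnP => m /eqP m0 m_min; split=> // n.
by apply: contraTneq => /eqP/m_min; rewrite leqNgt.
Qed.

Lemma abs_limit_none {R : realType} {alpha x : R} :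
  abs_limit alpha x = None -> forall n, abs_rem alpha x n != 0.
Proof.
rewrite /abs_limit; case: pselect => // h _ n.
by apply/negP => n0; apply: h; exists n.
Qed.

Lemma abs_rem_neq0 {R : realType} (alpha x : R) n :
  lt_limit n (abs_limit alpha x) -> abs_rem alpha x n != 0.
Proof.
case lE: (abs_limit alpha x) => [l|]; last by rewrite (abs_limit_none lE).
by have [_ neq0] := abs_limit_some lE; exact: neq0.
Qed.

Theorem corollary3p5 (R : realType) (alpha beta : R)
    (alpha01 : 0 < alpha < 1) (alpha_irr : irrational alpha)
    (beta01 : 0 < beta < 1) :
  let l := abs_limit alpha (1 - beta) in
  let b := abs_digit alpha (1 - beta) in
  let T := T_down alpha b in
  [/\ right_admissible alpha l b,
      forall n : nat, le_limit n l ->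
        (2 <= n)%N \/ abs_rem alpha (1 - beta) n < 2^-1 ->
        over_approximate alpha beta (T n)
    & general_solution alpha beta l T].
Proof.
move=> l b T.
have x01 : 0 <= 1 - beta < 1 by lra.
pose x := abs_rem alpha (1 - beta).
have x_itv n : 0 <= x n < cf_gap alpha n by exact: abs_rem_itv.
have gap1 n : cf_gap alpha n <= 1 by exact: cf_gap_le1.
have x_lt1 n : 0 <= x n < 1.
  by have /andP[-> /lt_le_trans->] := x_itv n.
have distE n : dist_int (beta - (T n)%:~R * alpha) = Num.min (x n) (1 - x n).
  have [z ->] := T_down_mod1 alpha alpha01 alpha_irr (1 - beta) n.
  (* Since the seed is 1 - beta, beta - T_n alpha = (1 - z) - x_n. *)
  rewrite -(dist_int_zsub _ (1 - z)) // rmorphB /=; congr dist_int.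
  by rewrite /x; ring.
have b_itv n : 0 <= b n.+1 <= cf_digit alpha n.+1 by exact: abs_digit_bound.
split.
- split.
  + by case.
  + case lE: l => [l'|]; last first.
      apply: limn_esup_ge => N; have x_neq0 := abs_limit_none lE.
      have [//|//|//|k Nk b1] := abs_digit_frequently_gt0 _ _ _ _ _ x_neq0 N.
      by exists k => //; rewrite lee_fin ler1z.
    (* A zero last digit would make the preceding remainder vanish too, against the minimality of
       the limit. *)
    case: l' lE => // l' lE _; have [xl0 x_neq0] := abs_limit_some lE.
    have := b_itv l'; have [//|b_lt1] := leP 1 (b l'.+1).
    have := x_neq0 l' (leqnn _); move: xl0; rewrite abs_remS// -/b => xl0 xn0.
    have [b0|] := eqVneq (b l'.+1) 0; last lia.
    by move: xl0 xn0; rewrite b0 mul0r subr0 => ->; rewrite eqxx.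
  + by case=> // k _ _; exact: abs_digit_max_next.
  + by move=> _ parity; exact: abs_digit_frequently_lt.
- move=> n _ n_small.
  (* From n = 2 on, x_n < [cf_gap alpha n] <= 1/2 by the two-step halving. *)
  have x_half : x n < 2^-1.
    case: n_small => // n2; have /andP[_ /lt_le_trans] := x_itv n; apply.
    case: n n2 => [|[|n]] // _.
    by have := cf_gapSS_le alpha alpha01 alpha_irr n; have := gap1 n; lra.
  have [z TE] := T_down_mod1 alpha alpha01 alpha_irr (1 - beta) n.
  (* This shift turns the fractional part of T_n alpha into x_n + beta. *)
  exists (Num.floor ((T n)%:~R * alpha) + 1 - z).
  rewrite /Defs.frac rmorphB rmorphD /= {1 3}/T TE -/(x n).
  by have /andP[] := x_lt1 n; lra.
split.
- by move=> n n1 _; exact: T_down_norm_le.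
- case=> // n _ n_lt; rewrite normr_theta// distE.
  have /andP[x0 xg] := x_itv n.+1.
  have /andP[_ x1] := x_lt1 n.+1.
  (* The minimum is positive because x_{n+1} < 1 and no remainder before the limit is 0; its first
     argument gives the upper bound. *)
  rewrite lt_min (subr_gt0 (x n.+1) 1) x1 andbT gt_min xg lt_neqAle x0 eq_sym !andbT.
  exact: abs_rem_neq0.
- case lE: l => [l'|].
    by have [xl0 _] := abs_limit_some lE; rewrite distE /x xl0 subr0 min_l.
  apply: (squeeze_cvgr _ (cvg_cst 0) (cvg_cf_gap alpha alpha01 alpha_irr)).
  near=> n; rewrite distE; have /andP[x0 xg] := x_itv n.
  have /andP[_ x1] := x_lt1 n.
  by rewrite le_min x0 (subr_ge0 (x n) 1) (ltW x1) ge_min (ltW xg).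
Unshelve. all: by end_near.
Qed.
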